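(* There exists a separable real Banach space $X$ which is $L$-embedded and has the Schur property, but which fails the $C$-Schur property for every $C\ge 0$.
   Context: All Banach spaces are real, and a Banach space $X$ is regarded as a subspace of its bidual $X^{**}$ via the canonical embedding. A Banach space $X$ has the Schur property if every weakly convergent sequence in $X$ is norm convergent. A Banach space $X$ is $L$-embedded if there is a (linear) projection $P:X^{**}\to X$ of $X^{**}$ onto $X$ such that $\|Px^{**}\|+\|(I-P)x^{**}\|=\|x^{**}\|$ for all $x^{**}\in X^{**}$. For a bounded sequence $(x_k)$ in $X$, $\operatorname{clust}_{X^{**}}(x_k)$ is the set of all weak* cluster points of $(x_k)$ in $X^{**}$; $\delta(x_k)$ is the (norm) diameter of $\operatorname{clust}_{X^{**}}(x_k)$; and $\operatorname{ca}(x_k)=\inf_{n\in\mathbb N}\operatorname{diam}\{x_k: k\ge n\}$. For $C\ge 0$, $X$ has the $C$-Schur property if $\operatorname{ca}(x_k)\le C\,\delta(x_k)$ for each bounded sequence $(x_k)$ in $X$. *)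

(* Defs.v *)
From HB Require Import structures.
From mathcomp Require Import all_boot all_order all_algebra.
From mathcomp Require Import all_classical all_reals all_analysis.

Set Implicit Arguments.
Unset Strict Implicit.
Unset Printing Implicit Defensive.

Import Order.TTheory GRing.Theory Num.Theory.
Import numFieldNormedType.Exports.

Local Open Scope classical_set_scope.
Local Open Scope ring_scope.

Section Dual.
Context {R : realType} {X : normedModType R}.

Definition dual_pred : {pred X -> R^o} :=
  mem [set f : X -> R^o | linear f /\ continuous f].

Record dual_space := Dual {
  dual_val :> X -> R^o;
  _ : dual_val \in dual_pred }.

HB.instance Definition _ := [isSub for dual_val].
HB.instance Definition _ := [Choice of dual_space by <:].

Lemma dual_submod_closed : submod_closed dual_pred.
Proof.
split=> [|a f g].
  rewrite inE; split; last exact: cst_continuous.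
  by move=> a x y /=; rewrite scaler0 addr0.
rewrite !inE => -[lf cf] [lg cg]; split.
  move=> b x y; rewrite !fctE lf lg !scalerDr !scalerA [b * a]mulrC.
  by rewrite addrACA.
by move=> x; apply: cvgD; [apply: cvgZr; exact: cf|exact: cg].
Qed.

HB.instance Definition _ :=
  GRing.isSubmodClosed.Build R (X -> R^o) dual_pred dual_submod_closed.
HB.instance Definition _ := [SubChoice_isSubLmodule of dual_space by <:].

Lemma dualP (f : dual_space) : linear f /\ continuous f.
Proof. by case: f => f /=; rewrite inE. Qed.

HB.instance Definition _ (f : dual_space) :=
  GRing.isLinear.Build R X R^o *:%R f (dualP f).1.

Definition dual_norm (f : dual_space) : R :=
  sup [set `|f x| | x in [set x : X | `|x| <= 1]].

Lemma dual_norm_has_sup (f : dual_space) :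
  has_sup [set `|f x| | x in [set x : X | `|x| <= 1]].
Proof.
split; first by exists `|f 0|, 0; rewrite //= normr0.
have /linear_bounded_continuous/bounded_funP/(_ 1)[M fM] := (dualP f).2.
by exists M => _ [x x1 <-]; exact: fM.
Qed.

Lemma dual_norm_ub1 (f : dual_space) (x : X) : `|x| <= 1 -> `|f x| <= dual_norm f.
Proof.
by move=> x1; apply: (ub_le_sup (dual_norm_has_sup f).2); exists x.
Qed.

Lemma dual_norm_ub (f : dual_space) (x : X) : `|f x| <= dual_norm f * `|x|.
Proof.
have [->|x0] := eqVneq x 0; first by rewrite linear0 !normr0 mulr0.
have nx : 0 < `|x| by rewrite normr_gt0.
rewrite -ler_pdivrMr// -[leLHS]mulrC -[X in X * _]gtr0_norm ?invr_gt0//.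
rewrite -normrM -[_ * f x]/(_ *: _) -linearZ.
by apply: dual_norm_ub1; rewrite normrZ gtr0_norm ?invr_gt0// mulVf ?gt_eqF.
Qed.

Lemma dual_norm_le (f : dual_space) (M : R) :
  (forall x, `|x| <= 1 -> `|f x| <= M) -> dual_norm f <= M.
Proof.
move=> fM; apply: ge_sup; first exact: (dual_norm_has_sup f).1.
by move=> _ [x x1 <-]; exact: fM.
Qed.

Lemma dual_normD (f g : dual_space) :
  dual_norm (f + g) <= dual_norm f + dual_norm g.
Proof.
apply: dual_norm_le => x x1; rewrite (le_trans (ler_normD _ _))//.
by rewrite lerD// dual_norm_ub1.
Qed.

Lemma dual_norm_ge0 (f : dual_space) : 0 <= dual_norm f.
Proof.
by rewrite (le_trans _ (@dual_norm_ub1 f 0 _))// normr0.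
Qed.

Lemma dual_normZ (a : R) (f : dual_space) :
  dual_norm (a *: f) = `|a| * dual_norm f.
Proof.
have le_normZ b (g : dual_space) : dual_norm (b *: g) <= `|b| * dual_norm g.
  apply: dual_norm_le => x x1.
  rewrite [X in `|X|](_ : _ = b * g x)// normrM ler_wpM2l//.
  exact: dual_norm_ub1.
apply/eqP; rewrite eq_le le_normZ/=.
have [->|a0] := eqVneq a 0; first by rewrite normr0 mul0r dual_norm_ge0.
rewrite -ler_pdivlMl ?normr_gt0// -normfV.
by rewrite -[f in leLHS](scalerK a0) le_normZ.
Qed.

Lemma dual_norm_eq0 (f : dual_space) : dual_norm f = 0 -> f = 0.
Proof.
move=> f0; apply/val_inj/funext => x; apply/eqP.
by rewrite -normr_le0 -(mul0r `|x|) -f0 dual_norm_ub.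
Qed.

HB.instance Definition _ :=
  Lmodule_isNormed.Build R dual_space dual_normD dual_normZ dual_norm_eq0.

End Dual.
Arguments dual_space {R} X.

Notation bidual X := (dual_space (dual_space X)).

Section CanonicalEmbedding.
Context {R : realType} {X : normedModType R}.

Lemma bidual_emb_subproof (x : X) :
  (fun f : dual_space X => f x : R^o) \in @dual_pred R (dual_space X).
Proof.
have lx : linear (fun f : dual_space X => f x : R^o) by [].
rewrite inE; split=> //.
pose L := GRing.isLinear.Build R (dual_space X) R^o *:%R _ lx.
pose ev : {linear dual_space X -> R^o} := HB.pack (fun f : dual_space X => f x : R^o) L.
apply: (@bounded_linear_continuous _ _ _ ev).
apply/bounded_funP => r; exists (r * `|x|) => f fr.
by rewrite (le_trans (dual_norm_ub f x))// ler_wpM2r.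
Qed.

Definition bidual_emb (x : X) : bidual X := Dual (bidual_emb_subproof x).

End CanonicalEmbedding.

Section Topologies.
Context {R : realType}.

(* Type aliases of X and dual_space X carrying sigma(X, X^* ) and
   sigma(X^*, X): a point is identified with the tuple of its values in the
   product R^(X^* ) (resp. R^X), and the space gets the initial topology. *)
Definition weak_space (X : normedModType R) : Type :=
  initial_topology (fun x : X => (fun f : dual_space X => f x) : {ptws dual_space X -> R}).

Definition weakstar_space (X : normedModType R) : Type :=
  initial_topology (fun f : dual_space X => (fun x : X => f x) : {ptws X -> R}).

HB.instance Definition _ X := Topological.on (weak_space X).
HB.instance Definition _ X := Topological.on (weakstar_space X).

End Topologies.

Section Properties.
Context {R : realType}.

Definition separable_space (T : topologicalType) : Prop :=
  exists2 D : set T, countable D & dense D.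

Definition weakly_convergent (X : normedModType R) (u : nat -> X) : Prop :=
  exists x : X, (u : nat -> weak_space X) @ \oo --> (x : weak_space X).

Definition Schur_property (X : normedModType R) : Prop :=
  forall u : nat -> X, weakly_convergent u -> cvg (u @ \oo).

(* X sits in its bidual through bidual_emb, so a projection of X^** onto X is a
   linear retraction P of bidual_emb; it is automatically onto. *)
Definition L_embedded (X : normedModType R) : Prop :=
  exists P : {linear bidual X -> X},
    (forall x, P (bidual_emb x) = x) /\
    (forall F, `|P F| + `|F - bidual_emb (P F)| = `|F|).

(* Diameters are extended reals, so unbounded sets cause no junk value; the
   diameter of the empty set is -oo, but it never arises for the sets used
   below: tails are nonempty, and so is clust u when u is bounded. *)
Definition diam (X : normedModType R) (A : set X) : \bar R :=
  ereal_sup [set `|x - y|%:E | x in A & y in A].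

Definition clust (X : normedModType R) (u : nat -> X) : set (bidual X) :=
  cluster ((bidual_emb \o u : nat -> weakstar_space (dual_space X)) @ \oo).

Definition delta (X : normedModType R) (u : nat -> X) : \bar R :=
  diam (clust u).

Definition ca (X : normedModType R) (u : nat -> X) : \bar R :=
  ereal_inf (range (fun n => diam (u @` [set k | (n <= k)%N]))).

Definition C_Schur_property (C : R) (X : normedModType R) : Prop :=
  forall u : nat -> X, bounded_fun u -> (ca u <= C%:E * delta u)%E.

End Properties.

(* Main.v *)
(** The space is the l_1-sum X over k of the spaces l_1 renormed by
    w_k ||x||_1 + ||x||_oo with w_k = 1/(k+1).  Each summand is the graph of the
    inclusion of (l_1, w_k ||.||_1) into c_0.  In row k the sequence (e_n) stays
    1-separated, but its weak* cluster points only see the summand w_k ||.||_1 and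
    so have norm at most w_k; as w_k tends to 0, no constant C works.

    A functional of norm at most 1 is a matrix a with
    sum_i max(0, |a_ki| - w_k) <= 1 for every k.  Hence one may glue a functional
    norming a truncated vector to an arbitrary functional off a finite box, after
    clipping the latter at w_k on finitely many rows; evaluating F in the bidual
    at the result gives ||F|| >= ||PF|| + ||F - PF||, where PF is the matrix of
    values of F at the coordinate functionals.

    For a weakly null sequence, a gliding hump inside each row makes the row norms
    tend to 0, and then a second one across the rows gives norm convergence. *)

Require Import Defs.
From HB Require Import structures.
From mathcomp Require Import all_boot all_order all_algebra.
From mathcomp Require Import all_classical all_reals all_analysis.
From mathcomp Require Import lra.
Import Order.TTheory GRing.Theory Num.Theory.
Import numFieldNormedType.Exports.
Local Open Scope classical_set_scope.
Local Open Scope ring_scope.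

Set Implicit Arguments.
Unset Strict Implicit.
Unset Printing Implicit Defensive.

(** * Truncated row norms and box norms of a matrix *)

Section RowSeminorms.
Context {R : realType}.
Implicit Types x y a : nat -> nat -> R^o.

Definition weight (k : nat) : R := k.+1%:R^-1.

Lemma weight_gt0 k : 0 < weight k.
Proof. by rewrite invr_gt0 ltr0n. Qed.

Lemma weight_le1 k : weight k <= 1.
Proof. by rewrite invf_le1 ?ltr0n// ler1n. Qed.

(** Only the first [I] columns enter, so these are finite sums and maxima, defined for every matrix;
    the norm arises later as a supremum. *)
Definition rowsum x k I : R := \sum_(0 <= i < I) `|x k i|.
Definition rowmax x k I : R := \big[Order.max/0]_(0 <= i < I) `|x k i|.
Definition rownorm x k I : R := weight k * rowsum x k I + rowmax x k I.
Definition boxnorm K I x : R := \sum_(0 <= k < K) rownorm x k I.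

Lemma rowsum_ge0 x k I : 0 <= rowsum x k I.
Proof. exact: sumr_ge0. Qed.

Lemma rowsum_cat x k I J : (I <= J)%N ->
  rowsum x k J = rowsum x k I + \sum_(I <= i < J) `|x k i|.
Proof. by move=> IJ; rewrite /rowsum (@big_cat_nat _ _ _ I). Qed.

Lemma rowsum_le x k I J : (I <= J)%N -> rowsum x k I <= rowsum x k J.
Proof.
by move=> IJ; rewrite (rowsum_cat _ _ IJ) lerDl sumr_ge0.
Qed.

Lemma rowmax_ge x k I i : (i < I)%N -> `|x k i| <= rowmax x k I.
Proof.
move=> iI; rewrite /rowmax big_mkord.
exact: (le_bigmax _ (fun i : 'I_I => `|x k i|) (Ordinal iI)).
Qed.

Lemma rowmax_ge0 x k I : 0 <= rowmax x k I.
Proof.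
case: I => [|I]; first by rewrite /rowmax big_geq.
by apply: (le_trans _ (@rowmax_ge x k I.+1 0 _)).
Qed.

Lemma rowmax_lub x k I M : 0 <= M -> (forall i, (i < I)%N -> `|x k i| <= M) ->
  rowmax x k I <= M.
Proof.
by move=> M0 xM; rewrite /rowmax big_mkord; apply: bigmax_le => // i _; exact: xM.
Qed.

Lemma rowmax_le x k I J : (I <= J)%N -> rowmax x k I <= rowmax x k J.
Proof. by move=> IJ; exact: le_bigmax_nat. Qed.

Lemma rowmax_le_rowsum x k I : rowmax x k I <= rowsum x k I.
Proof.
apply: rowmax_lub => [|i iI]; first exact: rowsum_ge0.
rewrite /rowsum big_mkord (bigD1 (Ordinal iI))//= lerDl.
exact: sumr_ge0.
Qed.

Lemma rownorm_ge0 x k I : 0 <= rownorm x k I.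
Proof.
by rewrite addr_ge0 ?rowmax_ge0// mulr_ge0 ?rowsum_ge0// ltW ?weight_gt0.
Qed.

Lemma rownorm_le x k I J : (I <= J)%N -> rownorm x k I <= rownorm x k J.
Proof.
move=> IJ; rewrite lerD ?rowmax_le// ler_pM2l ?weight_gt0//.
exact: rowsum_le.
Qed.

Lemma rownorm_coord x k I i : (i < I)%N -> `|x k i| <= rownorm x k I.
Proof.
move=> iI; rewrite (le_trans (rowmax_ge _ _ iI))// lerDr.
by rewrite mulr_ge0 ?rowsum_ge0// ltW ?weight_gt0.
Qed.

Lemma rownorm_le_rowsum x k I : rownorm x k I <= 2 * rowsum x k I.
Proof.
rewrite mulr_natl mulr2n lerD ?rowmax_le_rowsum//.
by rewrite ler_piMl ?rowsum_ge0// weight_le1.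
Qed.

Lemma rowsum_le_rownorm x k I : weight k * rowsum x k I <= rownorm x k I.
Proof. by rewrite lerDl rowmax_ge0. Qed.

Lemma eq_rownorm x y k I : (forall i, (i < I)%N -> `|x k i| = `|y k i|) ->
  rownorm x k I = rownorm y k I.
Proof.
move=> xy; rewrite /rownorm /rowsum /rowmax.
by congr (_ * _ + _); apply: eq_big_nat => i /andP[_ iI]; exact: xy.
Qed.

Lemma rownormD x y k I : rownorm (x + y) k I <= rownorm x k I + rownorm y k I.
Proof.
rewrite /rownorm addrACA -mulrDr lerD//.
  rewrite ler_pM2l ?weight_gt0// /rowsum -big_split ler_sum// => i _.
  exact: ler_normD.
apply: rowmax_lub => [|i iI]; first by rewrite addr_ge0 ?rowmax_ge0.
by rewrite (le_trans (ler_normD _ _))// lerD// rowmax_ge.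
Qed.

Lemma rownormZ (c : R) x k I : rownorm (c *: x) k I = `|c| * rownorm x k I.
Proof.
have E i : `|(c *: x) k i| = `|c| * `|x k i| by rewrite -normrM.
rewrite /rownorm mulrDr mulrCA; congr (_ * _ + _).
  by rewrite /rowsum mulr_sumr; apply: eq_bigr => i _.
rewrite /rowmax; elim/big_rec2: _ => [|i u v _ ->]; first by rewrite mulr0.
by rewrite E maxr_pMr.
Qed.

Lemma boxnorm_ge0 K I x : 0 <= boxnorm K I x.
Proof. by apply: sumr_ge0 => k _; exact: rownorm_ge0. Qed.

Lemma boxnorm_leI K I J x : (I <= J)%N -> boxnorm K I x <= boxnorm K J x.
Proof. by move=> IJ; apply: ler_sum => k _; exact: rownorm_le. Qed.

Lemma boxnorm_cat K L I x : (K <= L)%N ->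
  boxnorm L I x = boxnorm K I x + \sum_(K <= k < L) rownorm x k I.
Proof. by move=> KL; rewrite /boxnorm (@big_cat_nat _ _ _ K). Qed.

Lemma boxnorm_leK K L I x : (K <= L)%N -> boxnorm K I x <= boxnorm L I x.
Proof.
move=> KL; rewrite (boxnorm_cat _ _ KL) lerDl sumr_ge0// => k _.
exact: rownorm_ge0.
Qed.

Lemma boxnorm_le K L I J x : (K <= L)%N -> (I <= J)%N ->
  boxnorm K I x <= boxnorm L J x.
Proof. by move=> KL IJ; rewrite (le_trans (boxnorm_leI _ _ IJ))// boxnorm_leK. Qed.

Lemma rownorm_le_boxnorm K I x k : (k < K)%N -> rownorm x k I <= boxnorm K I x.
Proof.
move=> kK; rewrite /boxnorm big_mkord (bigD1 (Ordinal kK))//= lerDl.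
by apply: sumr_ge0 => j _; exact: rownorm_ge0.
Qed.

Lemma boxnormD K I x y : boxnorm K I (x + y) <= boxnorm K I x + boxnorm K I y.
Proof. by rewrite -big_split ler_sum// => k _; exact: rownormD. Qed.

Lemma boxnormZ (c : R) K I x : boxnorm K I (c *: x) = `|c| * boxnorm K I x.
Proof. by rewrite mulr_sumr; apply: eq_bigr => k _; exact: rownormZ. Qed.

Lemma boxnorm0 K I : boxnorm K I 0 = 0.
Proof. by rewrite -(scale0r 0) boxnormZ normr0 mul0r. Qed.

Lemma boxnorm_le_sum K I x :
  boxnorm K I x <= 2 * \sum_(0 <= k < K) \sum_(0 <= i < I) `|x k i|.
Proof. by rewrite mulr_sumr ler_sum// => k _; exact: rownorm_le_rowsum. Qed.

End RowSeminorms.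

(** * The normed space of matrices with bounded box norms *)

Section Space.
Context {R : realType}.

Definition bdd_pred : {pred nat -> nat -> R^o} :=
  mem [set x | exists M : R, forall n, boxnorm n n x <= M].

(* The norm, a sum over [k], is obtained as the supremum of the norms of the
   upper-left n x n corners. *)
Record mixedl1 := Mixedl1 {
  entries :> nat -> nat -> R^o;
  _ : entries \in bdd_pred }.

HB.instance Definition _ := [isSub for entries].
HB.instance Definition _ := [Choice of mixedl1 by <:].

Lemma bdd_submod_closed : submod_closed bdd_pred.
Proof.
split=> [|a x y]; first by rewrite inE; exists 0 => n; rewrite boxnorm0.
rewrite !inE => -[M xM] [N yN]; exists (`|a| * M + N) => n.
by rewrite (le_trans (boxnormD _ _ _ _))// boxnormZ lerD// ler_wpM2l.
Qed.

HB.instance Definition _ :=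
  GRing.isSubmodClosed.Build R (nat -> nat -> R^o) bdd_pred bdd_submod_closed.
HB.instance Definition _ := [SubChoice_isSubLmodule of mixedl1 by <:].

Implicit Types x y : mixedl1.

Lemma entriesD x y : entries (x + y) = entries x + entries y.
Proof. by []. Qed.

Lemma entriesZ (a : R) x : entries (a *: x) = a *: entries x.
Proof. by []. Qed.

Lemma entryB x y k i : (x - y) k i = x k i - y k i.
Proof. by []. Qed.

Lemma entryZ (a : R) x k i : (a *: x) k i = a * x k i.
Proof. by []. Qed.

Definition mixednorm x : R := sup (range (fun n => boxnorm n n x)).

Lemma mixednorm_ubound x : has_ubound (range (fun n => boxnorm n n x)).
Proof.
case: x => x /=; rewrite inE => -[M xM]; exists M => _ [n _ <-]; exact: xM.
Qed.

Lemma mixednorm_ge K I x : boxnorm K I x <= mixednorm x.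
Proof.
rewrite (le_trans (boxnorm_le _ (leq_maxl K I) (leq_maxr K I)))//.
by apply: (ub_le_sup (mixednorm_ubound x)); exists (maxn K I).
Qed.

Lemma mixednorm_le x (M : R) : (forall n, boxnorm n n x <= M) -> mixednorm x <= M.
Proof.
move=> xM; apply: ge_sup; first by exists (boxnorm 0 0 x), 0%N.
by move=> _ [n _ <-].
Qed.

Lemma mixednormD x y : mixednorm (x + y) <= mixednorm x + mixednorm y.
Proof.
apply: mixednorm_le => n; rewrite entriesD (le_trans (boxnormD _ _ _ _))//.
by rewrite lerD// mixednorm_ge.
Qed.

Lemma mixednormZ (a : R) x : mixednorm (a *: x) = `|a| * mixednorm x.
Proof.
(* The inequality suffices: its instance for [a^-1] and [a *: x] is the reverse one. *)
have le_normZ b y : mixednorm (b *: y) <= `|b| * mixednorm y.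
  by apply: mixednorm_le => n; rewrite entriesZ boxnormZ ler_wpM2l// mixednorm_ge.
apply/eqP; rewrite eq_le le_normZ/=.
have [->|a0] := eqVneq a 0.
  by rewrite normr0 mul0r (le_trans (boxnorm_ge0 0 0 _) (mixednorm_ge 0 0 _)).
rewrite -ler_pdivlMl ?normr_gt0// -normfV.
by rewrite -[x in leLHS](scalerK a0) le_normZ.
Qed.

Lemma entry_le_mixednorm x k i : `|x k i| <= mixednorm x.
Proof.
rewrite (le_trans (rownorm_coord _ _ (ltnSn i)))//.
by rewrite (le_trans (rownorm_le_boxnorm _ _ (ltnSn k)))// mixednorm_ge.
Qed.

Lemma mixednorm_eq0 x : mixednorm x = 0 -> x = 0.
Proof.
move=> x0; apply/val_inj/funext => k; apply/funext => i; apply/eqP.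
by rewrite -normr_le0 -x0 entry_le_mixednorm.
Qed.

HB.instance Definition _ :=
  Lmodule_isNormed.Build R mixedl1 mixednormD mixednormZ mixednorm_eq0.

Lemma mixedl1_eqP x y : (forall k i, x k i = y k i) -> x = y.
Proof.
by move=> xy; apply/val_inj/funext => k; apply/funext => i; exact: xy.
Qed.

Lemma norm_ge_box K I x : boxnorm K I x <= `|x|.
Proof. exact: mixednorm_ge. Qed.

Lemma norm_le_box x (M : R) : (forall n, boxnorm n n x <= M) -> `|x| <= M.
Proof. exact: mixednorm_le. Qed.

Lemma norm_ge_entry x k i : `|x k i| <= `|x|.
Proof. exact: entry_le_mixednorm. Qed.

Lemma boxnorm_cvg x : boxnorm n n x @[n --> \oo] --> `|x|.
Proof.
apply: nondecreasing_cvgn; last exact: mixednorm_ubound.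
by move=> m n mn; exact: boxnorm_le.
Qed.

End Space.
Arguments mixedl1 R : clear implicits.


(** * Completeness *)

Section Completeness.
Context {R : realType}.

(** The limit is taken entrywise. It is a norm limit because the box norms of its difference with
    [y] are bounded independently of the box, even though the element [z] used for the bound depends
    on the box. *)
Lemma mixedl1_complete (F : set_system (mixedl1 R)) :
  ProperFilter F -> cauchy F -> cvg F.
Proof.
move=> FF /cauchyP Fc.
have cF k i : cvg ((fun x : mixedl1 R => x k i : R^o) @ F).
  apply: (@cauchy_cvg R^o); apply: (@cauchy_exP _ R^o) => e e0.
  have [y yF] := Fc e e0.
  exists (y k i : R^o).
  have yz (z : mixedl1 R) : ball y e z -> ball (y k i : R^o) e (z k i : R^o).
    rewrite -!ball_normE /=; apply: le_lt_trans.
    exact: (norm_ge_entry (y - z)).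
  exact: (filterS yz yF).
pose l k i : R^o := lim ((fun x : mixedl1 R => x k i : R^o) @ F).
have near_l (e : R) : 0 < e ->
    \forall y \near F, forall n, boxnorm n n (l - entries y) <= e.
  move=> e0; have [y0 y0F] := Fc (e / 3) (divr_gt0 e0 (ltr0Sn R 2)).
  apply: filterS (y0F) => y y0y n.
  (* The 2 comes from [boxnorm_le_sum], [n ^ 2] counts the entries, and the successor keeps the
     divisor nonzero for [n = 0]. *)
  have d0 : 0 < e / 3 / (2 * (n ^ 2)%N.+1%:R) by rewrite !divr_gt0// mulr_gt0.
  have : \forall z \near F, forall (k : 'I_n) (i : 'I_n),
      `|l k i - entries z k i| <= e / 3 / (2 * (n ^ 2)%N.+1%:R).
    apply: filter_forall => k; apply: filter_forall => i.
    by have /cvgrPdist_le := cF k i; apply.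
  move=> nl; have [z [zl y0z]] := filter_ex (filterI nl y0F).
  (* One third of [e] pays for [l - z], and one more third for each of the distances from [z] and
     [y] to [y0]. *)
  have -> : l - entries y = (l - entries z) + (z - y).
    by rewrite addrA subrK.
  rewrite (le_trans (boxnormD _ _ _ _))//.
  have zy : boxnorm n n (z - y) <= e / 3 + e / 3.
    rewrite (le_trans (norm_ge_box _ _ (z - y)))//.
    rewrite (_ : z - y = (z - y0) + (y0 - y)); last by rewrite addrA subrK.
    rewrite (le_trans (ler_normD _ _))// lerD//; last first.
      by move: y0y; rewrite -ball_normE /= => /ltW.
    by rewrite distrC; move: y0z; rewrite -ball_normE /= => /ltW.
  have lz : boxnorm n n (l - entries z) <= e / 3.
    rewrite (le_trans (boxnorm_le_sum _ _ _))//.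
    set d := (X in _ <= X) in zl *.
    have : \sum_(0 <= k < n) \sum_(0 <= i < n) `|(l - entries z) k i|
       <= \sum_(0 <= k < n) \sum_(0 <= i < n) (e / 3 / (2 * (n ^ 2)%N.+1%:R)).
      rewrite !big_mkord ler_sum// => k _; rewrite !big_mkord ler_sum// => i _.
      exact: zl.
    rewrite !sumr_const_nat subn0 -mulrnA mulnn => le1.
    rewrite -ler_pdivlMl// (le_trans le1)//.
    rewrite invfM mulrA [e / 3 / 2]mulrC -mulrnAr ler_piMr//.
      by rewrite mulr_ge0// divr_ge0// ltW.
    by rewrite -mulr_natr mulrC ler_pdivrMr// mul1r ler_nat.
  by lra.
have lb : l \in bdd_pred.
  have [y ly] := filter_ex (near_l 1 ltr01).
  rewrite inE; exists (1 + `|y|) => n.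
  rewrite -[l](subrK (entries y)) (le_trans (boxnormD _ _ _ _))//.
  by rewrite lerD// norm_ge_box.
apply/cvg_ex; exists (Mixedl1 lb); apply/cvgrPdist_le => e e0.
by apply: filterS (near_l e e0) => y ly; exact: norm_le_box.
Qed.

HB.instance Definition _ := Uniform_isComplete.Build (mixedl1 R) mixedl1_complete.

End Completeness.

(** * Finitely supported matrices: density and separability *)

Section Truncation.
Context {R : realType}.
Implicit Types (x y : mixedl1 R) (a b : nat -> nat -> R^o).

Lemma sum_nat_delta (V : nmodType) (F : nat -> V) n m :
  \sum_(0 <= j < n) (if j == m then F j else 0) = if (m < n)%N then F m else 0.
Proof. by rewrite -big_mkcond big_nat1_eq. Qed.

Definition unit_entries (k i : nat) : nat -> nat -> R^o :=
  fun l j => if l == k then if j == i then 1 else 0 else 0.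

Lemma boxnorm_unit_entries k i n : boxnorm n n (unit_entries k i) <= 2.
Proof.
rewrite (le_trans (boxnorm_le_sum _ _ _))//.
rewrite ler_piMr// (eq_bigr (fun l => if l == k then
    \sum_(0 <= j < n) (if j == i then (1 : R) else 0) else 0)).
  rewrite sum_nat_delta sum_nat_delta.
  by case: ifP => // _; case: ifP.
move=> l _; rewrite /unit_entries; case: eqP => _.
  by apply: eq_bigr => j _; case: eqP => _; rewrite ?normr1 ?normr0.
by rewrite big1// => j _; rewrite normr0.
Qed.

Lemma unit_entries_bdd k i : unit_entries k i \in bdd_pred.
Proof. by rewrite inE; exists 2; exact: boxnorm_unit_entries. Qed.

Definition unitv k i : mixedl1 R := Mixedl1 (unit_entries_bdd k i).

Lemma unitvE k i l j :
  unitv k i l j = if l == k then if j == i then 1 else 0 else 0.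
Proof. by []. Qed.

Lemma unitvC k i l j : unitv k i l j = unitv l j k i.
Proof. by rewrite !unitvE [l == k]eq_sym [j == i]eq_sym. Qed.

Lemma norm_unitv k i : `|unitv k i| <= 2.
Proof. by apply: norm_le_box => n; exact: boxnorm_unit_entries. Qed.

Lemma sum_mul_unitv K I a k i :
  \sum_(0 <= l < K) \sum_(0 <= j < I) a l j * unitv k i l j =
  if (k < K)%N then if (i < I)%N then a k i else 0 else 0.
Proof.
rewrite (eq_bigr (fun l => if l == k then
    \sum_(0 <= j < I) (if j == i then a l j else 0) else 0)).
  by rewrite (sum_nat_delta (fun l => \sum_(0 <= j < I)
    (if j == i then a l j else 0))) (sum_nat_delta (a k)).
move=> l _; case: (eqVneq l k) => [->|lk].
  by apply: eq_bigr => j _; rewrite unitvE eqxx; case: eqP => _;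
    rewrite ?mulr1 ?mulr0.
by rewrite big1// => j _; rewrite unitvE (negPf lk) mulr0.
Qed.

(** The argument is an arbitrary matrix, so that the coordinates of an element of the bidual can be
    truncated before they are known to lie in the space. *)
Definition trunc K I a : mixedl1 R :=
  \sum_(0 <= k < K) \sum_(0 <= i < I) a k i *: unitv k i.

Lemma entry_sum (T : Type) (s : seq T) (F : T -> mixedl1 R) k i :
  (\sum_(t <- s) F t : mixedl1 R) k i = \sum_(t <- s) F t k i.
Proof. exact: (big_morph (fun x : mixedl1 R => x k i : R)). Qed.

Lemma truncE K I a k i :
  trunc K I a k i = if (k < K)%N then if (i < I)%N then a k i else 0 else 0.
Proof.
rewrite /trunc entry_sum -[RHS]sum_mul_unitv; apply: eq_bigr => l _.
by rewrite entry_sum; apply: eq_bigr => j _; rewrite entryZ unitvC.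
Qed.

Lemma norm_trunc K I a : `|trunc K I a| = boxnorm K I a.
Proof.
have E k : (k < K)%N -> rownorm (trunc K I a) k I = rownorm a k I.
  by move=> kK; apply: eq_rownorm => i iI; rewrite truncE kK iI.
apply/eqP; rewrite eq_le; apply/andP; split; last first.
  rewrite (le_trans _ (norm_ge_box K I _))// /boxnorm big_nat [leRHS]big_nat.
  by apply: ler_sum => k /andP[_ /E->].
apply: norm_le_box => n; set m := maxn n (maxn K I).
have nm : (n <= m)%N by rewrite leq_maxl.
have Km : (K <= m)%N by rewrite /m !leq_max leqnn !orbT.
have Im : (I <= m)%N by rewrite /m !leq_max leqnn !orbT.
rewrite (le_trans (boxnorm_le _ nm nm))// (boxnorm_cat _ _ Km).
rewrite [X in _ + X]big_nat [X in _ + X]big1 ?addr0; last first.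
  move=> k /andP[Kk _]; apply/eqP; rewrite eq_le rownorm_ge0 andbT.
  have r0 : rowsum (trunc K I a) k m = 0.
    by apply: big1 => i _; rewrite truncE ltnNge Kk /= normr0.
  by rewrite (le_trans (rownorm_le_rowsum _ _ _))// r0 mulr0.
rewrite /boxnorm big_nat [leRHS]big_nat ler_sum// => k /andP[_ kK].
rewrite -(E _ kK) lerD//.
  rewrite ler_pM2l ?weight_gt0// /rowsum (big_cat_nat _ Im)//=.
  rewrite [X in _ + X]big_nat [X in _ + X]big1 ?addr0// => i /andP[Ii _].
  by rewrite truncE kK ltnNge Ii /= normr0.
apply: rowmax_lub => [|i _]; first exact: rowmax_ge0.
have [iI|Ii] := ltnP i I; first exact: rowmax_ge.
by rewrite truncE kK ltnNge Ii /= normr0 rowmax_ge0.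
Qed.

(** First [K] makes the rows from [K] on small, then [I0] makes the remaining columns of the first
    [K] rows small. The columns may be extended freely afterwards, which lets [I] meet further
    thresholds. *)
Lemma trunc_approx x (e : R) : 0 < e ->
  exists K I0, forall I, (I0 <= I)%N -> `|x - trunc K I x| <= e.
Proof.
move=> e0; have e20 : 0 < e / 2 by rewrite divr_gt0.
have [_ [K _ <-] xK] := sup_adherent e20
  (conj (ex_intro _ _ (ex_intro2 _ _ 0%N Logic.I erefl)) (mixednorm_ubound x)).
have bK : has_ubound (range (fun I => boxnorm K I x)).
  by exists `|x| => _ [I _ <-]; exact: norm_ge_box.
(* The growth of the row norm controls the l_1 tail of row [k] only after multiplication by
   [weight k]; [weight K] bounds these weights from below, whence this factor. *)
pose d := weight K * (e / 4).
have d0 : 0 < d by rewrite mulr_gt0 ?weight_gt0// divr_gt0.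
have [_ [I1 _ <-] xI1] := sup_adherent d0
  (conj (ex_intro _ _ (ex_intro2 _ _ 0%N Logic.I erefl)) bK).
exists K, (maxn K I1) => I; rewrite geq_max => /andP[KI I1I].
apply: norm_le_box => n; set m := maxn n (maxn K I).
have nm : (n <= m)%N by rewrite leq_maxl.
have Km : (K <= m)%N by rewrite /m !leq_max leqnn !orbT.
have Im : (I <= m)%N by rewrite /m !leq_max leqnn !orbT.
rewrite (le_trans (boxnorm_le _ nm nm))// (boxnorm_cat _ _ Km).
have -> : \sum_(K <= k < m) rownorm (x - trunc K I x) k m =
          \sum_(K <= k < m) rownorm x k m.
  apply: eq_big_nat => k /andP[Kk _]; apply: eq_rownorm => i _.
  rewrite entryB truncE ltnNge Kk /=.
  by rewrite subr0.
have tail : \sum_(K <= k < m) rownorm x k m <= e / 2.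
  have := norm_ge_box m m x; rewrite (boxnorm_cat _ _ Km).
  have := boxnorm_leI K x (leq_trans KI Im).
  move: xK; rewrite -[sup _]/(`|x|); lra.
have head : boxnorm K m (x - trunc K I x) <= e / 2.
  (* The maxima do not subtract, but they grow with the box. So the growth of [rownorm] dominates
     the weighted l_1 tail, and the row norm of the tail is at most twice its l_1 norm. *)
  have : weight K * boxnorm K m (x - trunc K I x) <=
      2 * (boxnorm K m x - boxnorm K I x).
    rewrite /boxnorm -sumrB !mulr_sumr big_nat [leRHS]big_nat ler_sum// => k.
    move=> /andP[_ kK].
    have -> : rownorm x k m - rownorm x k I =
        weight k * (rowsum x k m - rowsum x k I) + (rowmax x k m - rowmax x k I).
      by rewrite /rownorm; lra.
    have : rowsum (x - trunc K I x) k m = rowsum x k m - rowsum x k I.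
      rewrite (rowsum_cat x k Im) [RHS]addrC addKr (rowsum_cat _ k Im).
      rewrite {1}/rowsum big_nat big1 ?add0r; last first.
        move=> i /andP[_ iI].
        rewrite entryB truncE kK iI.
        by rewrite subrr normr0.
      apply: eq_big_nat => i /andP[Ii _].
      rewrite entryB truncE kK ltnNge Ii /=.
      by rewrite subr0.
    have r0 := rowsum_ge0 (x - trunc K I x) k m.
    have := rownorm_le_rowsum (x - trunc K I x) k m.
    have wk : weight K <= weight k :> R.
      by rewrite lef_pV2 ?posrE ?ltr0n// ler_nat ltnW.
    have w0 := @weight_gt0 R K.
    have m0 := rowmax_le x k Im.
    move=> h1 h2; rewrite -h2.
    apply: (@le_trans _ _ (weight K * (2 * rowsum (x - trunc K I x) k m))).
      by rewrite ler_pM2l.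
    have := ler_wpM2r r0 wk; lra.
  have : boxnorm K m x <= sup (range (fun I => boxnorm K I x)).
    by apply: ub_le_sup => //; exists m.
  have := boxnorm_leI K x I1I.
  have := @weight_gt0 R K => w0 h1 h2 h3.
  rewrite -(ler_pM2l w0) (le_trans h3)//; move: xI1; rewrite /d; lra.
by lra.
Qed.

(** Finitely supported rational matrices are countable and approximate every truncation. *)
Lemma mixedl1_separable : separable_space (mixedl1 R).
Proof.
pose q (s : seq (seq rat)) k i : R^o := ratr (nth 0 (nth [::] s k) i).
pose g (t : nat * nat * seq (seq rat)) := trunc t.1.1 t.1.2 (q t.2).
exists (range g).
  exact: (card_le_trans (card_image_le g setT) (countableP setT)).
move=> O [x Ox] oO; have /nbhs_ballP[e /= e0 eO] := open_nbhs_nbhs (conj oO Ox).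
have e30 : 0 < e / 3 by rewrite divr_gt0.
have [K [I /(_ I (leqnn _)) xKI]] := trunc_approx x e30.
(* The factor 2 again comes from [boxnorm_le_sum], now with [K * I] entries; the successor covers an
   empty box. *)
have d0 : 0 < e / 3 / (2 * (K * I).+1%:R) by rewrite !divr_gt0// mulr_gt0.
set d := e / 3 / _ in d0.
have /choice[r rP] : forall t : nat * nat, exists p : rat, `|x t.1 t.2 - ratr p| <= d.
  move=> t; have /rat_in_itvoo[p] : x t.1 t.2 - d < x t.1 t.2 + d by lra.
  rewrite in_itv /= => /andP[p1 p2]; exists p.
  by rewrite ler_distl; lra.
pose s := mkseq (fun k => mkseq (fun i => r (k, i)) I) K.
exists (g (K, I, s)); split; last by exists (K, I, s).
apply: eO; rewrite -ball_normE /=.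
rewrite (_ : x - _ = (x - trunc K I x) + (trunc K I x - g (K, I, s))); last first.
  by rewrite addrA subrK.
rewrite (le_lt_trans (ler_normD _ _))//.
have -> : trunc K I x - g (K, I, s) = trunc K I (entries x - q s).
  apply: mixedl1_eqP => k i.
  rewrite entryB !truncE.
  by case: ifP => _; [case: ifP => _|]; rewrite ?subrr.
suff : `|trunc K I (entries x - q s)| <= e / 3 by lra.
rewrite norm_trunc (le_trans (boxnorm_le_sum _ _ _))//.
have : \sum_(0 <= k < K) \sum_(0 <= i < I) `|(entries x - q s) k i| <=
    \sum_(0 <= k < K) \sum_(0 <= i < I) d.
  rewrite big_nat [leRHS]big_nat ler_sum// => k /andP[_ kK].
  rewrite big_nat [leRHS]big_nat ler_sum// => i /andP[_ iI].
  rewrite -[X in `|X|]/(x k i - q s k i) /q /s nth_mkseq// nth_mkseq//.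
  exact: (rP (k, i)).
rewrite !sumr_const_nat !subn0 -mulrnA => le1.
rewrite -ler_pdivlMl// (le_trans le1)// /d.
rewrite invfM mulrA [e / 3 / 2]mulrC -mulrnAr ler_piMr//.
  by rewrite mulr_ge0// ltW.
by rewrite -mulr_natr mulrC ler_pdivrMr// mul1r ler_nat mulnC.
Qed.

End Truncation.

(** * Functionals given by a norm bound *)

Section BoundedFunctionals.
Context {R : realType} {X : normedModType R}.

Lemma bounded_dual_pred (f : X -> R^o) (c : R) :
  linear f -> (forall x, `|f x| <= c * `|x|) -> f \in @dual_pred R X.
Proof.
move=> lf fc; rewrite inE; split=> //.
pose L := GRing.isLinear.Build R X R^o *:%R _ lf.
pose g : {linear X -> R^o} := HB.pack f L.
apply: (@bounded_linear_continuous _ _ _ g).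
apply/bounded_funP => r; exists (`|c| * r) => x xr.
rewrite (le_trans (fc x))// (le_trans (ler_wpM2r (normr_ge0 x) (ler_norm c)))//.
by rewrite ler_wpM2l.
Qed.

Lemma dual_val_sum (T : Type) (s : seq T) (F : T -> dual_space X) (x : X) :
  (\sum_(t <- s) F t : dual_space X) x = \sum_(t <- s) F t x.
Proof. exact: (big_morph (fun f : dual_space X => f x : R)). Qed.

Lemma dual_valB (f g : dual_space X) (x : X) : (f - g) x = f x - g x.
Proof. by []. Qed.

Lemma dual_valD (f g : dual_space X) (x : X) : (f + g) x = f x + g x.
Proof. by []. Qed.

Lemma dual_valZ (a : R) (f : dual_space X) (x : X) : (a *: f) x = a * f x.
Proof. by []. Qed.

Lemma norm_dual_ub (f : dual_space X) (x : X) : `|f x| <= `|f| * `|x|.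
Proof. exact: dual_norm_ub. Qed.

Lemma norm_dual_le (f : dual_space X) (c : R) : 0 <= c ->
  (forall x, `|f x| <= c * `|x|) -> `|f| <= c.
Proof.
move=> c0 fc; apply: dual_norm_le => x x1.
by rewrite (le_trans (fc x))// ler_piMr.
Qed.

End BoundedFunctionals.

(** * Dual balls as sets of admissible matrices *)

Section DualOfMixedl1.
Context {R : realType}.
Implicit Types (x y : mixedl1 R) (a b : nat -> nat -> R^o).
Implicit Types (f g : dual_space (mixedl1 R)).

Lemma coord_dual_pred k i :
  (fun x => x k i : R^o) \in @dual_pred R (mixedl1 R).
Proof.
apply: (@bounded_dual_pred _ _ _ 1) => // x.
by rewrite mul1r norm_ge_entry.
Qed.

Definition coordf k i : dual_space (mixedl1 R) := Dual (coord_dual_pred k i).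

Lemma coordfE k i x : coordf k i x = x k i.
Proof. by []. Qed.

Lemma dual_trunc f K I a : f (trunc K I a) =
  \sum_(0 <= k < K) \sum_(0 <= i < I) a k i * f (unitv k i).
Proof.
rewrite /trunc linear_sum; apply: eq_bigr => k _.
by rewrite linear_sum; apply: eq_bigr => i _; rewrite linearZ.
Qed.

(** Finitely supported matrices are dense, so the values on unit matrices determine a functional. *)
Lemma dual_eqP f g :
  (forall k i, f (unitv k i) = g (unitv k i)) -> f = g.
Proof.
move=> fg; apply/val_inj/funext => x; apply/eqP; rewrite -subr_eq0 -normr_le0.
apply/ler_addgt0Pr => e e0; rewrite add0r.
have c0 : 0 < `|f - g| + 1 by rewrite ltr_wpDl.
have [K [I /(_ I (leqnn _)) xe]] := trunc_approx x (divr_gt0 e0 c0).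
rewrite -[f x - g x]/((f - g) x).
have fgx : (f - g) x = (f - g) (x - trunc K I x) + (f - g) (trunc K I x).
  by rewrite -linearD subrK.
have t0 : (f - g) (trunc K I x) = 0.
  by rewrite dual_trunc big1// => k _; rewrite big1// => i _;
    rewrite dual_valB fg subrr mulr0.
rewrite fgx t0 addr0 (le_trans (norm_dual_ub _ _))//.
move: xe; rewrite ler_pdivlMr// => xe.
by rewrite (le_trans _ xe)// mulrC ler_wpM2l// lerDl.
Qed.

(* The [a] with [admissible c a] are the matrices of the functionals of norm at
   most [c]: the dual norm on row [k] is the interpolation gauge between
   [weight k * l_oo] and [l_1]. *)
Definition admissible (c : R) a := forall k I,
  \sum_(0 <= i < I) Order.max 0 (`|a k i| - c * weight k) <= c.

Lemma admissible_ge0 c a : admissible c a -> 0 <= c.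
Proof. by move=> /(_ 0 0)%N; rewrite big_geq. Qed.

(** Each [a k i] is in absolute value at most [c * weight k] plus its excess. The first part pairs
    with the l_1 sum, and the excesses, of sum at most [c], pair with the maximum. *)
Lemma admissible_row c a x k I : admissible c a ->
  \sum_(0 <= i < I) `|a k i * x k i| <= c * rownorm x k I.
Proof.
move=> ac; have c0 := admissible_ge0 ac.
have -> : c * rownorm x k I =
    c * weight k * rowsum x k I + c * rowmax x k I.
  by rewrite /rownorm mulrDr mulrA.
apply: (@le_trans _ _ (c * weight k * rowsum x k I +
  (\sum_(0 <= i < I) Order.max 0 (`|a k i| - c * weight k)) * rowmax x k I)).
  rewrite mulr_sumr mulr_suml -big_split ler_sum_nat// => i /andP[_ iI] /=.
  have xm := rowmax_ge x k iI.
  have : `|a k i| <= c * weight k + Order.max 0 (`|a k i| - c * weight k).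
    by rewrite -lerBlDl le_max lexx orbT.
  have m0 : 0 <= Order.max 0 (`|a k i| - c * weight k) by rewrite le_max lexx.
  move=> /(ler_wpM2r (normr_ge0 (x k i))); rewrite normrM => /le_trans; apply.
  by rewrite mulrDl lerD2l ler_wpM2l.
by rewrite lerD2l ler_wpM2r// rowmax_ge0.
Qed.

Definition boxpair K I a x : R :=
  \sum_(0 <= k < K) \sum_(0 <= i < I) a k i * x k i.

(** The limit runs over square corners; it exists when [a] is admissible. *)
Definition pairing a x : R^o := lim (boxpair n n a x @[n --> \oo]).

Lemma boxpair_le c a x n : admissible c a -> `|boxpair n n a x| <= c * `|x|.
Proof.
move=> ac; have c0 := admissible_ge0 ac.
rewrite (le_trans (ler_norm_sum _ _ _))//.
apply: le_trans (ler_wpM2l c0 (norm_ge_box n n x)).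
rewrite mulr_sumr ler_sum// => k _.
by rewrite (le_trans (ler_norm_sum _ _ _))// admissible_row.
Qed.

Lemma boxpair_is_cvg c a x : admissible c a -> cvg (boxpair n n a x @[n --> \oo]).
Proof.
move=> ac; have c0 := admissible_ge0 ac.
(* splits off the positive part: both |a x| and |a x| - a x have monotone box sums *)
have mono (F : nat -> nat -> R) : (forall k i, 0 <= F k i) ->
    (forall n, \sum_(0 <= k < n) \sum_(0 <= i < n) F k i <= 2 * (c * `|x|)) ->
    cvg (\sum_(0 <= k < n) \sum_(0 <= i < n) F k i @[n --> \oo]).
  move=> F0 Fb; apply: nondecreasing_is_cvgn; last first.
    by exists (2 * (c * `|x|)) => _ [n _ <-].
  move=> m n mn; rewrite [leRHS](big_cat_nat _ mn)//=.
  apply: (@le_trans _ _ (\sum_(0 <= k < m) \sum_(0 <= i < n) F k i)).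
    apply: ler_sum => k _; rewrite [leRHS](big_cat_nat _ mn)//= lerDl.
    exact: sumr_ge0.
  by rewrite lerDl sumr_ge0// => k _; exact: sumr_ge0.
have bnd n : \sum_(0 <= k < n) \sum_(0 <= i < n) `|a k i * x k i| <= c * `|x|.
  apply: le_trans (ler_wpM2l c0 (norm_ge_box n n x)).
  by rewrite mulr_sumr ler_sum// => k _; exact: admissible_row.
have cx0 : 0 <= c * `|x| by rewrite mulr_ge0.
have -> : (fun n => boxpair n n a x) =
   (fun n => \sum_(0 <= k < n) \sum_(0 <= i < n) `|a k i * x k i|) -
   (fun n => \sum_(0 <= k < n) \sum_(0 <= i < n) (`|a k i * x k i| - a k i * x k i)).
  apply/funext => n; rewrite /boxpair !fctE -sumrB; apply: eq_bigr => k _.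
  by rewrite -sumrB; apply: eq_bigr => i _; rewrite subKr.
apply: is_cvgB; apply: mono => //.
- by move=> n; rewrite (le_trans (bnd n))// ler_peMl// ler1n.
- by move=> k i; rewrite subr_ge0 ler_norm.
move=> n; rewrite mulr_natl mulr2n.
have := bnd n; have := boxpair_le x n ac.
rewrite ler_norml => /andP[+ _] => h1 h2.
rewrite (eq_bigr (fun k => \sum_(0 <= i < n) `|a k i * x k i| -
   \sum_(0 <= i < n) (a k i * x k i))); last by move=> k _; rewrite sumrB.
by rewrite sumrB lerD// lerNl.
Qed.

Lemma pairing_le c a x : admissible c a -> `|pairing a x| <= c * `|x|.
Proof.
move=> ac; have ca := @boxpair_is_cvg c a x ac.
rewrite -lim_norm//; apply: limr_le; first exact: is_cvg_norm.
by apply: nearW => n; exact: boxpair_le.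
Qed.

Lemma pairing_dual_pred c a : admissible c a ->
  pairing a \in @dual_pred R (mixedl1 R).
Proof.
move=> ac; apply: (@bounded_dual_pred _ _ _ c); last first.
  by move=> x; exact: pairing_le.
move=> r x y; apply: (@cvg_lim R^o) => //.
have -> : (fun n => boxpair n n a (r *: x + y)) =
    (fun n => r *: (boxpair n n a x : R^o) + (boxpair n n a y : R^o)).
  apply/funext => n; rewrite /boxpair scaler_sumr -big_split.
  apply: eq_bigr => k _; rewrite scaler_sumr -big_split; apply: eq_bigr => i _.
  rewrite -[in LHS]/(a k i * (r * x k i + y k i)) mulrDr mulrCA.
  by [].
by apply: cvgD; [apply: cvgZr|]; exact: boxpair_is_cvg ac.
Qed.

Definition pairing_dual c a (ac : admissible c a) : dual_space (mixedl1 R) :=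
  Dual (pairing_dual_pred ac).

Lemma pairing_dual_norm c a (ac : admissible c a) : `|pairing_dual ac| <= c.
Proof.
apply: norm_dual_le; first exact: admissible_ge0 ac.
by move=> x; exact: pairing_le.
Qed.

Lemma pairing_trunc a K I b : 
  pairing a (trunc K I b) = \sum_(0 <= k < K) \sum_(0 <= i < I) a k i * b k i.
Proof.
apply: (@cvg_lim R^o) => //; apply: cvg_near_cst.
exists (maxn K I) => // n /=; rewrite geq_max => /andP[Kn In].
rewrite /boxpair (big_cat_nat _ Kn)//= [X in _ + X]big_nat [X in _ + X]big1 ?addr0.
  apply: eq_big_nat => k /andP[_ kK].
  rewrite (big_cat_nat _ In)//= [X in _ + X]big_nat [X in _ + X]big1 ?addr0.
    by apply: eq_big_nat => i /andP[_ iI]; rewrite truncE kK iI.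
  by move=> i /andP[Ii _]; rewrite truncE kK ltnNge Ii /= mulr0.
move=> k /andP[Kk _]; rewrite big1// => i _.
by rewrite truncE ltnNge Kk /= mulr0.
Qed.

Lemma pairing_unitv a k i : pairing a (unitv k i) = a k i.
Proof.
have -> : unitv k i = trunc k.+1 i.+1 (unitv k i) :> mixedl1 R.
  apply: mixedl1_eqP => l j; rewrite truncE unitvE.
  by case: eqP => [->|]; rewrite ?ltnSn; [case: eqP => [->|]|];
    rewrite ?ltnSn// => _; case: ifP => //; case: ifP.
by rewrite pairing_trunc sum_mul_unitv !ltnSn.
Qed.

(** Sufficiency half of the description of dual balls: [f] is the pairing with [a], since both agree
    on unit matrices. *)
Lemma dual_norm_admissible f c a : admissible c a ->
  (forall k i, f (unitv k i) = a k i) -> `|f| <= c.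
Proof.
move=> ac fa; suff -> : f = pairing_dual ac by exact: pairing_dual_norm.
by apply: dual_eqP => k i; rewrite fa -pairing_unitv.
Qed.

(** Necessity half. The test matrix [b] carries, in row [k], the signs of the entries exceeding
    [c * weight k]. If [N] counts those in the first [I] columns, the truncation has norm at most
    [weight k * N + 1], while [f] takes on it the sum of their absolute values; subtracting
    [c * weight k * N] leaves the sum of the excesses. *)
Lemma admissible_dual f : admissible `|f| (fun k i => f (unitv k i)).
Proof.
move=> k I; set c := `|f|; set a := fun k i => f (unitv k i).
pose J i := c * weight k < `|a k i|.
pose b : nat -> nat -> R^o := fun l i =>
  if l == k then if J i then Num.sg (a k i) else 0 else 0.
pose N : R := \sum_(0 <= i < I) (if J i then 1 else 0).
have bn : `|trunc k.+1 I b| <= weight k * N + 1.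
  rewrite norm_trunc /boxnorm big_nat_recr//= big_nat big1 ?add0r; last first.
    move=> l /andP[_ lk]; apply/eqP; rewrite eq_le rownorm_ge0 andbT.
    have r0 : rowsum b l I = 0.
      by apply: big1 => i _; rewrite /b (ltn_eqF lk) normr0.
    by rewrite (le_trans (rownorm_le_rowsum _ _ _))// r0 mulr0.
  have b1 i : `|b k i| <= 1.
    rewrite /b eqxx; case: ifP => _; last by rewrite normr0.
    by rewrite normr_sg; case: (_ != _); rewrite ?lexx ?ler01.
  rewrite lerD//; last by apply: rowmax_lub => // i _; exact: b1.
  rewrite ler_pM2l ?weight_gt0// ler_sum// => i _.
  case: ifPn => Ji; first exact: b1.
  by rewrite /b eqxx (negPf Ji) normr0.
have fb : f (trunc k.+1 I b) = \sum_(0 <= i < I) (if J i then `|a k i| else 0).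
  rewrite dual_trunc big_nat_recr//= big_nat big1 ?add0r; last first.
    by move=> l /andP[_ lk]; rewrite big1// => i _; rewrite /b (ltn_eqF lk) mul0r.
  apply: eq_bigr => i _; rewrite /b eqxx; case: ifP => _; last by rewrite mul0r.
  by rewrite [in RHS]normrEsg.
have := norm_dual_ub f (trunc k.+1 I b).
rewrite fb ger0_norm; last first.
  by apply: sumr_ge0 => i _; case: ifP.
move=> /le_trans/(_ (ler_wpM2l (normr_ge0 f) bn)); rewrite -/c.
rewrite mulrDr mulr1 mulrA -lerBlDl.
apply: le_trans; rewrite /N mulr_sumr -sumrB ler_sum// => i _.
rewrite /J; case: ltP => ca; last by rewrite mulr0 subr0 ge_max lexx subr_le0.
by rewrite mulr1 ge_max lexx subr_ge0 (ltW ca).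
Qed.

Lemma admissibleW (c d : R) a : c <= d -> admissible c a -> admissible d a.
Proof.
move=> cd ac k I; rewrite (le_trans _ cd)// (le_trans _ (ac k I))// ler_sum// => i _.
rewrite ge_max le_max lexx /= le_max lerD2l lerN2 ler_wpM2r ?orbT//.
by rewrite ltW ?weight_gt0.
Qed.

End DualOfMixedl1.

(** * Norming functionals *)

Section Norming.
Context {R : realType}.
Implicit Types (x y : mixedl1 R) (a b : nat -> nat -> R^o).

(** The entries of a row tend to 0, so a nonzero row attains its maximum among finitely many
    columns. *)
Lemma row_argmax x k : exists j, forall i, `|x k i| <= `|x k j|.
Proof.
have [[j xj]|x0] := pselect (exists j, x k j != 0); last first.
  exists 0%N => i; suff -> : x k i = 0 by rewrite normr0.
  by apply: contrapT => /eqP xi; apply: x0; exists i.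
have xj0 : 0 < `|x k j| by rewrite normr_gt0.
have [K [I /(_ I (leqnn _)) xI]] := trunc_approx x (divr_gt0 xj0 (ltr0Sn R 1)).
have small i : (I <= i)%N -> `|x k i| <= `|x k j| / 2.
  move=> Ii; apply: le_trans (le_trans (norm_ge_entry _ k i) xI).
  by rewrite entryB truncE (leq_gtF Ii) if_same subr0.
have tail i : (I <= i)%N -> `|x k i| <= `|x k j|.
  by move=> /small; move: xj0; lra.
have jI : (j < I)%N.
  by rewrite ltnNge; apply/negP => /small; move: xj0; lra.
case: (arg_maxP (fun i : 'I_I => `|x k i|) (isT : predT (Ordinal jI))) => l _ lmax.
exists l => i; have [iI|/tail xij] := ltnP i I; first exact: (lmax (Ordinal iI)).
exact: (le_trans xij (lmax (Ordinal jI) isT)).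
Qed.

Definition argrow x k : nat := projT1 (cid (row_argmax x k)).

Lemma argrowP x k i : `|x k i| <= `|x k (argrow x k)|.
Proof. exact: (projT2 (cid (row_argmax x k))). Qed.

(** The signed weights recover the weighted l_1 part, and the extra 1 at the argmax recovers the
    maximum. *)
Definition norming x : nat -> nat -> R^o := fun k i =>
  (weight k + if i == argrow x k then 1 else 0) * Num.sg (x k i).

(** The only possible excess in a row is the 1 at the argmax. Row [k] may norm its own vector [z k],
    since admissibility is tested row by row; the hump across rows uses this freedom. *)
Lemma admissible_norming (z : nat -> mixedl1 R) :
  admissible 1 (fun k => norming (z k) k).
Proof.
move=> k I.
apply: (@le_trans _ _ (\sum_(0 <= i < I) if i == argrow (z k) k then (1 : R) else 0)).
  apply: ler_sum => i _; rewrite /norming mul1r.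
  have w0 : 0 < weight k :> R by exact: weight_gt0.
  have s1 : `|Num.sg (z k k i)| <= 1.
    by rewrite normr_sg; case: (_ != _); rewrite ?lexx ?ler01.
  rewrite ge_max normrM; case: eqP => _.
    rewrite ler01 /= gtr0_norm ?addr_gt0//.
    rewrite lerBlDl -[leRHS]mulr1 ler_wpM2l// ltW// addr_gt0//.
  rewrite lexx /= addr0 gtr0_norm// subr_le0.
  by rewrite -[leRHS]mulr1 ler_wpM2l// ltW.
by rewrite sum_nat_delta; case: ifP.
Qed.

Lemma norming_row x k I : (argrow x k < I)%N ->
  \sum_(0 <= i < I) norming x k i * x k i = rownorm x k I.
Proof.
move=> aI; rewrite (eq_bigr (fun i => weight k * `|x k i| +
   if i == argrow x k then `|x k i| else 0)); last first.
  move=> i _; rewrite /norming -mulrA -normrEsg mulrDl.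
  by case: ifP; rewrite ?mul1r ?mul0r.
rewrite big_split /= sum_nat_delta aI -mulr_sumr; congr (_ + _).
apply/eqP; rewrite eq_le rowmax_ge//= rowmax_lub// => i _.
exact: argrowP.
Qed.

Lemma norming_trunc K I a :
  \sum_(0 <= k < K) \sum_(0 <= i < I)
    norming (trunc K I a) k i * a k i = boxnorm K I a.
Proof.
set t := trunc K I a.
rewrite -norm_trunc.
rewrite -(cvg_lim (@norm_hausdorff _ R) (@boxnorm_cvg _ (trunc K I a))).
apply/esym/(cvg_lim (@norm_hausdorff _ R)); apply: cvg_near_cst.
(* The chosen argmax of a zero row may lie outside the box. Squares containing the argmaxes of all
   rows [k < K] avoid this, and their box norms already equal the norm of the truncation. *)
pose M := \max_(k < K) (argrow t k).+1.
exists (maxn M (maxn K I)) => // n /=; rewrite !geq_max => /and3P[Mn Kn In].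
rewrite (boxnorm_cat _ _ Kn) [X in _ + X]big_nat [X in _ + X]big1 ?addr0; last first.
  move=> k /andP[Kk _]; apply/eqP; rewrite eq_le rownorm_ge0 andbT.
  have r0 : rowsum t k n = 0.
    by apply: big1 => i _; rewrite /t truncE ltnNge Kk /= normr0.
  by rewrite (le_trans (rownorm_le_rowsum _ _ _))// r0 mulr0.
apply: eq_big_nat => k /andP[_ kK].
have an : (argrow t k < n)%N.
  apply: leq_trans Mn.
  exact: (@leq_bigmax _ (fun l : 'I_K => (argrow t l).+1) (Ordinal kK)).
rewrite -norming_row// (big_cat_nat _ In)//= [X in _ + X]big_nat.
rewrite [X in _ + X]big1 ?addr0; last first.
  move=> i /andP[Ii _].
  have -> : t k i = 0 by rewrite /t truncE kK (leq_gtF Ii).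
  by rewrite mulr0.
apply: eq_big_nat => i /andP[_ iI].
by have -> : t k i = a k i by rewrite /t truncE kK iI.
Qed.

End Norming.

(** * The projection of the bidual and L-embeddedness *)

Section LEmbedding.
Context {R : realType}.
Implicit Types (x y : mixedl1 R) (a b : nat -> nat -> R^o).
Implicit Types (f g : dual_space (mixedl1 R)) (F : bidual (mixedl1 R)).

(** On these finite combinations of coordinate functionals an element of the bidual acts through its
    coordinates alone. *)
Definition boxdual K I b : dual_space (mixedl1 R) :=
  \sum_(0 <= k < K) \sum_(0 <= i < I) b k i *: coordf k i.

Lemma boxdual_unitv K I b k i : boxdual K I b (unitv k i) =
  if (k < K)%N then if (i < I)%N then b k i else 0 else 0.
Proof.
rewrite /boxdual dual_val_sum -[RHS]sum_mul_unitv; apply: eq_bigr => l _.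
by rewrite dual_val_sum; apply: eq_bigr => j _; rewrite dual_valZ coordfE.
Qed.

Lemma bidual_boxdual F K I b : F (boxdual K I b) =
  \sum_(0 <= k < K) \sum_(0 <= i < I) b k i * F (coordf k i).
Proof.
rewrite /boxdual linear_sum; apply: eq_bigr => k _.
by rewrite linear_sum; apply: eq_bigr => i _; rewrite linearZ.
Qed.

Definition bidual_coords F : nat -> nat -> R^o := fun k i => F (coordf k i).

(** In each row the excesses over the weight have sum at most 1, so their tails vanish; finitely
    many rows admit a common threshold. *)
Lemma excess_tail a K (e : R) : 0 < e -> admissible 1 a ->
  exists I1, forall k I n, (k < K)%N -> (I1 <= I)%N ->
    \sum_(I <= i < n) Order.max 0 (`|a k i| - weight k) <= e.
Proof.
move=> e0 a1.
have m0 k i : 0 <= Order.max 0 (`|a k i| - weight k) by rewrite le_max lexx.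
have /choice[J JP] : forall k, exists J, forall I n, (J <= I)%N ->
    \sum_(I <= i < n) Order.max 0 (`|a k i| - weight k) <= e.
  move=> k; pose s n : R := \sum_(0 <= i < n) Order.max 0 (`|a k i| - weight k).
  have sb : has_ubound (range s).
    exists 1 => _ [n _ <-]; rewrite (le_trans _ (a1 k n))// ler_sum// => i _.
    by rewrite mul1r.
  have [_ [J _ <-] sJ] := sup_adherent e0
    (conj (ex_intro _ _ (ex_intro2 _ _ 0%N Logic.I erefl)) sb).
  exists J => I n JI; have [nI|/ltnW In] := leqP n I; first by rewrite big_geq// ltW.
  have sn : s n <= sup (range s) by apply: ub_le_sup => //; exists n.
  have sI : s J <= s I by rewrite /s (big_cat_nat _ JI)//= lerDl sumr_ge0.
  have -> : \sum_(I <= i < n) Order.max 0 (`|a k i| - weight k) = s n - s I.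
    by rewrite /s (@big_cat_nat _ _ _ I 0 n)//= [RHS]addrC addKr.
  by move: sJ; lra.
exists (\max_(k < K) J k) => k I n kK MI; apply: JP; apply: leq_trans MI.
exact: (@leq_bigmax _ (fun l : 'I_K => J l) (Ordinal kK)).
Qed.

(* Glues a norming functional of the truncation on the box to [f] outside it.
   Clipping [f] at the weight on the rows [k < K], columns [i >= I] keeps the norm
   of the result at most [1], and the clipped-off part is small. *)
Lemma glued_functional f K (e : R) b : 0 < e -> `|f| <= 1 ->
  exists I1, forall I, (I1 <= I)%N -> exists u : dual_space (mixedl1 R),
    `|u| <= e /\
    `|boxdual K I (norming (trunc K I b)) + f
      - boxdual K I (fun k i => f (unitv k i)) - u| <= 1.
Proof.
move=> e0 f1; set a := fun k i => f (unitv k i).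
have a1 : admissible 1 a := admissibleW f1 (@admissible_dual _ f).
have [I1 I1P] := excess_tail K e0 a1.
exists I1 => I I1I.
(* [v] is the signed excess of [a] over the weight, so [a - v] is [a] clipped at the weight. *)
pose v k i : R^o := Num.sg (a k i) * Order.max 0 (`|a k i| - weight k).
have vE k i : `|v k i| = Order.max 0 (`|a k i| - weight k).
  rewrite /v normrM normr_sg.
  have [->|_] := eqVneq (a k i) 0; last first.
    by rewrite mul1r ger0_norm// le_max lexx.
  rewrite mul0r normr0; apply/esym/max_idPl.
  by rewrite sub0r lerNl oppr0 ltW ?weight_gt0.
have av k i : `|a k i - v k i| <= weight k.
  have w0 := @weight_gt0 R k.
  rewrite {1}[a k i]numEsg /v -mulrBr normrM normr_sg.
  have [->|_] := eqVneq (a k i) 0; first by rewrite mul0r ltW.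
  rewrite mul1r; have := normr_ge0 (a k i) => n0; rewrite ler_norml.
  by have [h|h] := leP 0 (`|a k i| - weight k); apply/andP; lra.
(* [w] is the excess removed by clipping; each of its rows has l_1 norm at most [e], so it is
   admissible for [e]. *)
pose w k i : R^o := if (k < K)%N then if (i < I)%N then 0 else v k i else 0.
have we : admissible e w.
  move=> k n; apply: (@le_trans _ _ (\sum_(0 <= i < n) `|w k i|)).
    apply: ler_sum => i _; rewrite ge_max normr_ge0 /= gerBl.
    by rewrite mulr_ge0 ?ltW ?weight_gt0.
  have [kK|Kk] := ltnP k K; last first.
    by rewrite big1 ?ltW// => i _; rewrite /w (leq_gtF Kk) normr0.
  have [nI|/ltnW In] := leqP n I.
    rewrite big_nat big1 ?ltW// => i /andP[_ ni].
    by rewrite /w kK (leq_trans ni nI) normr0.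
  rewrite (big_cat_nat _ In)//= [X in X + _]big_nat [X in X + _]big1 ?add0r.
    apply: le_trans (I1P k I n kK I1I); apply: ler_sum_nat => i /andP[Ii _].
    by rewrite /w kK (leq_gtF Ii) vE.
  by move=> i /andP[_ iI]; rewrite /w kK iI normr0.
exists (pairing_dual we); split; first exact: pairing_dual_norm.
pose h k i : R^o :=
  if (k < K)%N then if (i < I)%N then norming (trunc K I b) k i
                   else a k i - v k i else a k i.
apply: (@dual_norm_admissible _ _ _ h); last first.
  move=> k i; rewrite !dual_valB dual_valD !boxdual_unitv.
  rewrite -[pairing_dual we _]/(pairing w (unitv k i)) pairing_unitv -/(a k i).
  rewrite /h /w; case: (ltnP k K) => _; last by rewrite add0r !subr0.
  by case: (ltnP i I) => _; [rewrite subr0 addrK|rewrite add0r subr0].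
move=> k n; have [kK|Kk] := ltnP k K; last first.
  rewrite (le_trans _ (a1 k n))// ler_sum// => i _.
  by rewrite /h (leq_gtF Kk).
(* In a row [k < K] the clipped entries have no excess, which leaves only the excess of the norming
   matrix. *)
rewrite (le_trans _ (admissible_norming (fun=> trunc K I b) k n))// ler_sum//.
move=> i _; rewrite /h kK; case: ifP => // _; rewrite ge_max !le_max lexx /=.
by rewrite mul1r subr_le0 av.
Qed.

(** [F] is evaluated at the glued functional [h], of norm at most 1, and at the correction [u]. On
    the norming part [F] yields the box norm of its coordinates, and on the box part of [f] it
    yields [f] at the truncated coordinates. *)
Lemma bidual_box_ineq F f K (e : R) : 0 < e -> `|f| <= 1 ->
  exists I1, forall I, (I1 <= I)%N ->
    boxnorm K I (bidual_coords F) + F f - f (trunc K I (bidual_coords F))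
      <= `|F| + e * `|F|.
Proof.
move=> e0 f1; set x := bidual_coords F.
have [I1 I1P] := glued_functional K x e0 f1.
exists I1 => I /I1P[u [ue]].
set A := boxdual K I _; set B := boxdual K I _ => h1.
set h := A + f - B - u in h1.
have Fh : F h <= `|F|.
  rewrite (le_trans (ler_norm _))// (le_trans (norm_dual_ub _ _))//.
  by rewrite ler_piMr.
have Fu : F u <= e * `|F|.
  rewrite (le_trans (ler_norm _))// (le_trans (norm_dual_ub _ _))//.
  by rewrite mulrC ler_wpM2r.
suff -> : boxnorm K I x + F f - f (trunc K I x) = F h + F u by rewrite lerD.
have -> : F h = F A + F f - F B - F u by rewrite /h !linearB linearD.
rewrite subrK /A /B !bidual_boxdual dual_trunc.
rewrite -[in LHS](norming_trunc K I x); congr (_ + _ - _).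
by apply: eq_bigr => k _; apply: eq_bigr => i _; rewrite mulrC.
Qed.

(** The box inequality at [f = 0] and [e = 1] bounds all box norms by twice the norm of [F]. *)
Lemma bidual_coords_bdd F : bidual_coords F \in bdd_pred.
Proof.
rewrite inE; exists (`|F| + 1 * `|F|) => n.
have [|I1 I1P] := @bidual_box_ineq F 0 n 1 ltr01; first by rewrite normr0.
rewrite (le_trans (boxnorm_leI n _ (leq_maxl n I1)))//.
have := I1P _ (leq_maxr n I1).
by rewrite linear0 -[(0 : dual_space _) _]/(0 : R) subr0 addr0.
Qed.

Definition bidual_proj F : mixedl1 R := Mixedl1 (bidual_coords_bdd F).

Lemma bidual_proj_linear : linear bidual_proj.
Proof. by move=> r F G; apply: mixedl1_eqP. Qed.

HB.instance Definition _ := GRing.isLinear.Build R (bidual (mixedl1 R)) (mixedl1 R)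
  *:%R bidual_proj bidual_proj_linear.

Lemma bidual_projK x : bidual_proj (bidual_emb x) = x.
Proof. exact: mixedl1_eqP. Qed.

(** This is the box inequality with the truncation removed: [f] tests
    [F - bidual_emb (bidual_proj F)], and the other term is the norm of the projection. *)
Lemma bidual_proj_sub F f : `|f| <= 1 ->
  F f - f (bidual_proj F) + `|bidual_proj F| <= `|F|.
Proof.
move=> f1; set x := bidual_proj F; apply/ler_addgt0Pr => e e0.
have c0 : 0 < `|F| + 2 by rewrite ltr_wpDl.
(* Clipping costs [d] times the norm of [F], and truncation costs [d] once in the norm and once
   under [f]; together they make [e]. *)
have d0 : 0 < e / (`|F| + 2) by rewrite divr_gt0.
set d := e / _ in d0.
have dE : d * `|F| + 2 * d = e by rewrite /d [2 * _]mulrC -mulrDr divfK ?gt_eqF.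
have [K [I0 xd]] := trunc_approx x d0.
have [I1 I1P] := bidual_box_ineq F K d0 f1.
have {}xd := xd _ (leq_maxl I0 I1).
have := I1P _ (leq_maxr I0 I1); set I := maxn I0 I1 in xd *.
rewrite -[bidual_coords F]/(entries x) -norm_trunc.
have xt : `|x| <= `|x - trunc K I x| + `|trunc K I x|.
  by rewrite -[x in leLHS](subrK (trunc K I x)) ler_normD.
have : `|f (x - trunc K I x)| <= d.
  by rewrite (le_trans (norm_dual_ub _ _))// (le_trans _ xd)// ler_piMl.
rewrite linearB ler_norml => /andP[+ _].
by move: xt xd dE; lra.
Qed.

Lemma mixedl1_L_embedded : L_embedded (mixedl1 R).
Proof.
exists bidual_proj; split; first exact: bidual_projK.
move=> F; apply/eqP; rewrite eq_le; apply/andP; split; last first.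
  have emb_le x : `|bidual_emb x| <= `|x|.
    by apply: norm_dual_le => // f; rewrite mulrC; exact: (norm_dual_ub f x).
  rewrite -[F in leLHS](subrK (bidual_emb (bidual_proj F))) addrC.
  by rewrite (le_trans (ler_normD _ _))// lerD2r emb_le.
rewrite -lerBrDl; apply: dual_norm_le => f f1.
rewrite -[(F - _) f]/(F f - f (bidual_proj F)) ler_norml.
have := bidual_proj_sub F f1.
(* Testing with [- f] as well controls the absolute value. *)
have := @bidual_proj_sub F (- f); rewrite normrN => /(_ f1).
rewrite linearN -[(- f) _]/(- (f (bidual_proj F))).
by move=> h1 h2; apply/andP; split; lra.
Qed.

End LEmbedding.

(** * Evaluation of functionals along weak limits and weak* cluster points *)

Section WeakTopologies.
Context {R : realType} {X : normedModType R}.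

Lemma weak_cvg_eval (u : nat -> X) (x : X) (f : dual_space X) :
  (u : nat -> weak_space X) @ \oo --> (x : weak_space X) ->
  (f (u n) : R) @[n --> \oo] --> (f x : R).
Proof.
move=> ux.
pose ev := fun x : X => (fun f : dual_space X => f x) : {ptws dual_space X -> R}.
have h1 : (ev (u n) @[n --> \oo]) --> (ev x : {ptws dual_space X -> R}).
  exact: (continuous_cvg _ (@initial_continuous _ _ ev x) ux).
exact: (continuous_cvg _ (@proj_continuous (dual_space X) (fun=> R) f (ev x)) h1).
Qed.

(** A weak* neighbourhood of [F] given by evaluation at [f] meets every tail of the sequence, so
    [F f] is within [e] of a value bounded by [c]. *)
Lemma clust_eval (u : nat -> X) (F : bidual X) (f : dual_space X) (c : R) :
  clust u F -> (\forall n \near \oo, `|f (u n)| <= c) -> `|F f| <= c.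
Proof.
move=> uF uc; apply/ler_addgt0Pr => e e0.
pose ev := fun G : bidual X =>
  (fun f : dual_space X => G f) : {ptws dual_space X -> R}.
have nF : nbhs (F : weakstar_space (dual_space X))
    [set G : bidual X | ball (F f : R) e (G f : R)].
  have h1 := @initial_continuous _ _ ev F.
  have h2 := @proj_continuous (dual_space X) (fun=> R) f (ev F).
  exact: (cvg_comp _ _ h1 h2 _ (nbhsx_ballx (F f : R) e e0)).
have fu : ((bidual_emb \o u : nat -> weakstar_space (dual_space X)) @ \oo)
    [set G : bidual X | `|G f| <= c] by exact: uc.
have [G [/= Gc]] := uF _ _ fu nF.
rewrite -ball_normE /= => /ltW FG.
rewrite -[F f](subrK (G f)) addrC (le_trans (ler_normD _ _))// lerD//.
Qed.

End WeakTopologies.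

(** * An abstract gliding hump *)

Section GlidingHump.
Context {R : realType}.

(* [q b n] is the size of the block [b] of the [n]-th vector, [Q n] its total size
   and [T s n] the value at the [n]-th vector of a functional that norms the block
   [b] of the vector number [s b] for every [b]. *)
Lemma gliding_hump (q : nat -> nat -> R) (Q : nat -> R) (T : (nat -> nat) -> nat -> R) :
  (forall b n, 0 <= q b n) ->
  (forall n, \sum_(0 <= b < B) q b n @[B --> \oo] --> Q n) ->
  (forall b, q b n @[n --> \oo] --> 0) ->
  (forall s n B B', (forall b, (B <= b < B')%N -> s b = n) -> (B <= B')%N ->
     2 * \sum_(B <= b < B') q b n - Q n <= T s n) ->
  (forall s, T s n @[n --> \oo] --> 0) ->
  Q n @[n --> \oo] --> 0.
Proof.
move=> q0 qQ qb HT T0.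
have Q0 n : 0 <= Q n.
  by apply: (cvgr_to_ge (qQ n)); apply: nearW => B; exact: sumr_ge0.
apply: contrapT => nQ.
have [e e0 big] : exists2 e : R, 0 < e & forall N, exists2 n, (N <= n)%N & e <= Q n.
  apply: contrapT => H; apply: nQ; apply/cvgr0Pnorm_lt => e e0.
  apply: contrapT => nN; apply: H; exists e => // N.
  apply: contrapT => H; apply: nN; exists N => // n /= Nn.
  by rewrite ger0_norm// ltNge; apply/negP => eQ; apply: H; exists n.
have e8 : 0 < e / 8 by rewrite divr_gt0.
have headsmall B : \forall n \near \oo, \sum_(0 <= b < B) q b n <= e / 8.
  have : \sum_(0 <= b < B) q b n @[n --> \oo] --> 0.
    elim: B => [|B IH].
      by under eq_fun do rewrite big_geq//; exact: cvg_cst.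
    under eq_fun do rewrite big_nat_recr//=.
    by have h := cvgD IH (qb B); rewrite addr0 in h; exact: h.
  by move=> /cvgr_le; apply.
(* A state pairs a vector number with a block boundary. The next vector is large with little mass
   before the boundary, and the next boundary leaves little of its mass beyond it. *)
have step (t : nat * nat) : {t' : nat * nat | [/\ (t.1 < t'.1)%N, (t.2 < t'.2)%N,
    e <= Q t'.1, \sum_(0 <= b < t.2) q b t'.1 <= e / 8 &
    Q t'.1 - e / 8 <= \sum_(0 <= b < t'.2) q b t'.1]}.
  apply: cid; have [N _ NP] := headsmall t.2.
  have [n Nn en] := big (maxn N t.1.+1).
  have [M _ MP] : \forall B \near \oo, Q n - e / 8 <= \sum_(0 <= b < B) q b n.
    by apply: (cvgr_ge _ (qQ n)); lra.
  exists (n, maxn M t.2.+1); split=> //=.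
  - by rewrite (leq_trans _ Nn)// leq_maxr.
  - by rewrite leq_maxr.
  - by apply: NP => /=; rewrite (leq_trans _ Nn)// leq_maxl.
  - by apply: MP => /=; rewrite leq_maxl.
have [h [_ hP]] := dependent_choice step (0, 0)%N.
have h1 j : (j <= (h j).1)%N.
  by elim: j => // j IH; have [+ _ _ _ _] := hP j; exact: leq_ltn_trans.
have h2lt : {homo (fun j => (h j).2) : i j / (i < j)%N}.
  by apply: homo_ltn; [exact: ltn_trans|] => j; have [] := hP j.
have h2le : {homo (fun j => (h j).2) : i j / (i <= j)%N}.
  by apply: homo_leq; [exact: leqnn|exact: leq_trans|] => j; have [_ /ltnW] := hP j.
(* [s b] is the vector whose hump lives on the interval of blocks containing [b] *)
have /choice[s sP] : forall b, exists n, forall j,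
    ((h j).2 <= b < (h j.+1).2)%N -> n = (h j.+1).1.
  move=> b; have [[j jb]|nj] := pselect (exists j, ((h j).2 <= b < (h j.+1).2)%N).
    exists (h j.+1).1 => i ib; suff -> : i = j by [].
    case/andP: jb ib => j1 j2 /andP[i1 i2]; apply/eqP.
    rewrite eqn_leq (leqNgt i j) (leqNgt j i); apply/andP; split; apply/negP.
      by move=> /h2le h3; move: (leq_trans (leq_trans j2 h3) i1); rewrite ltnn.
    by move=> /h2le h3; move: (leq_trans (leq_trans i2 h3) j1); rewrite ltnn.
  by exists 0%N => j jb; exfalso; apply: nj; exists j.
have /cvgr0Pnorm_lt/(_ (e / 4)) := T0 s.
case=> [|N _ NP]; first by rewrite divr_gt0.
have [_ /ltnW hN hQ hh ht] := hP N.
have := NP _ (leq_trans (leqnSn N) (h1 N.+1)); rewrite /=.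
apply/negP; rewrite -leNgt.
(* At most [e / 8] of the mass lies on either side of the hump, so the value is at least the total
   minus [e / 2], hence at least [e / 2], against the bound [e / 4]. *)
have Ts := HT s (h N.+1).1 (h N).2 (h N.+1).2 (fun b bh => sP b N bh) hN.
rewrite (le_trans _ (ler_norm _))// (le_trans _ Ts)//.
move: ht; rewrite (@big_cat_nat _ _ _ (h N).2 0)//=.
by lra.
Qed.

End GlidingHump.

(** * The Schur property *)

Section SchurProperty.
Context {R : realType}.
Implicit Types (x y : mixedl1 R) (a b : nat -> nat -> R^o).

Lemma pairing_ge c a x (M : R) : admissible c a ->
  (\forall n \near \oo, M <= boxpair n n a x) -> M <= pairing a x.
Proof. by move=> ac; apply: limr_ge; exact: (@boxpair_is_cvg _ c). Qed.

Section WeaklyNull.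
Context (u : nat -> mixedl1 R)
  (u0 : forall f : dual_space (mixedl1 R), f (u n) @[n --> \oo] --> (0 : R)).

Lemma entry_cvg0 k i : `|u n k i| @[n --> \oo] --> 0.
Proof. by have /cvg_norm := u0 (coordf k i); rewrite normr0. Qed.

Definition rowl1 x k : R := lim (rowsum x k I @[I --> \oo]).

Lemma rowsum_cvg x k : rowsum x k I @[I --> \oo] --> rowl1 x k.
Proof.
apply: nondecreasing_is_cvgn; first by move=> I J; exact: rowsum_le.
exists ((weight k)^-1 * `|x|) => _ [I _ <-]; rewrite ler_pdivlMl ?weight_gt0//.
rewrite (le_trans (rowsum_le_rownorm _ _ _))//.
by rewrite (le_trans (rownorm_le_boxnorm _ _ (ltnSn k)))// norm_ge_box.
Qed.

Lemma rowsum_le_rowl1 x k I : rowsum x k I <= rowl1 x k.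
Proof.
apply: (cvgr_to_ge (@rowsum_cvg x k)); exists I => // J /= IJ.
exact: rowsum_le.
Qed.

(** A gliding hump with single entries as blocks. Signs of varying vectors, scaled by [weight k] and
    confined to row [k], have no excess over the weight, so they form an admissible matrix; dividing
    the pairing by [weight k] restores the l_1 scale. *)
Lemma rowl1_cvg0 k : rowl1 (u n) k @[n --> \oo] --> 0.
Proof.
pose a (s : nat -> nat) l i : R^o :=
  if l == k then weight k * Num.sg (u (s i) k i) else 0.
have a1 s : admissible 1 (a s).
  move=> l I; rewrite big1 ?ler01// => i _; apply/max_idPl; rewrite mul1r subr_le0.
  rewrite /a; case: eqP => [->|_]; last by rewrite normr0 ltW ?weight_gt0.
  rewrite normrM normr_sg gtr0_norm ?weight_gt0//.
  by rewrite ler_piMr ?(ltW (weight_gt0 _))//; case: (_ != _).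
apply: (@gliding_hump _ (fun i n => `|u n k i|) (fun n => rowl1 (u n) k)
   (fun s n => (weight k)^-1 * pairing (a s) (u n))).
- by [].
- by move=> n; exact: rowsum_cvg.
- exact: entry_cvg0.
- move=> s n B B' sn BB'; rewrite ler_pdivlMl ?weight_gt0//.
  apply: (pairing_ge (a1 s)); exists (maxn k.+1 B') => // m /=.
  rewrite geq_max => /andP[km Bm].
  have -> : boxpair m m (a s) (u n) = \sum_(0 <= l < m) (if l == k then
      weight k * \sum_(0 <= i < m) Num.sg (u (s i) k i) * u n k i else 0).
    apply: eq_bigr => l _; rewrite /a; case: eqP => [->|_]; last first.
      by rewrite big1// => i _; rewrite mul0r.
    by rewrite mulr_sumr; apply: eq_bigr => i _; rewrite mulrA.
  rewrite sum_nat_delta km ler_pM2l ?weight_gt0//.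
  have := rowsum_le_rowl1 (u n) k m; rewrite /rowsum.
  rewrite !(@big_cat_nat _ _ _ B 0 m)//= ?(leq_trans BB')//.
  rewrite !(@big_cat_nat _ _ _ B' B m)//=.
  have mid : \sum_(B <= i < B') Num.sg (u (s i) k i) * u n k i =
             \sum_(B <= i < B') `|u n k i|.
    by apply: eq_big_nat => i /sn ->; rewrite -normrEsg.
  (* Off the block the signs may belong to other vectors; there each entry costs at most its
     absolute value, which gives twice the block minus the total. *)
  have low D D' : - \sum_(D <= i < D') `|u n k i| <=
      \sum_(D <= i < D') Num.sg (u (s i) k i) * u n k i.
    rewrite -sumrN ler_sum// => i _; rewrite lerNl -mulNr.
    rewrite (le_trans (ler_norm _))// normrM normrN normr_sg.
    by rewrite ler_piMl//; case: (_ != _); rewrite ?ler01.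
  have := low 0%N B; have := low B' m; rewrite mid; lra.
- move=> s; have := u0 (pairing_dual (a1 s)).
  by move=> /(cvgM (cvg_cst (weight k)^-1)); rewrite mulr0.
Qed.

Definition rowlim x k : R := lim (rownorm x k I @[I --> \oo]).

Lemma rownorm_cvg x k : rownorm x k I @[I --> \oo] --> rowlim x k.
Proof.
apply: nondecreasing_is_cvgn; first by move=> I J; exact: rownorm_le.
exists `|x| => _ [I _ <-].
by rewrite (le_trans (rownorm_le_boxnorm _ _ (ltnSn k)))// norm_ge_box.
Qed.

Lemma rownorm_le_rowlim x k I : rownorm x k I <= rowlim x k.
Proof.
apply: (cvgr_to_ge (@rownorm_cvg x k)); exists I => // J /= IJ.
exact: rownorm_le.
Qed.

Lemma rowlim_ge0 x k : 0 <= rowlim x k.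
Proof. exact: le_trans (rownorm_ge0 x k 0) (rownorm_le_rowlim x k 0). Qed.

Lemma rowlim_le x k : rowlim x k <= 2 * rowl1 x k.
Proof.
apply: (cvgr_to_le (@rownorm_cvg x k)); apply: nearW => I.
rewrite (le_trans (rownorm_le_rowsum _ _ _))// ler_pM2l//.
exact: rowsum_le_rowl1.
Qed.

Lemma sum_rownorm_cvg x K L :
  \sum_(K <= k < L) rownorm x k I @[I --> \oo] --> \sum_(K <= k < L) rowlim x k.
Proof.
have [LK|/ltnW KL] := leqP L K.
  by under eq_fun do rewrite big_geq//; rewrite big_geq//; exact: cvg_cst.
rewrite -(subnKC KL); elim: (L - K)%N => [|d IH].
  by under eq_fun do rewrite addn0 big_geq//; rewrite addn0 big_geq//; exact: cvg_cst.
under eq_fun do rewrite addnS big_nat_recr ?leq_addr//=.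
by rewrite addnS big_nat_recr ?leq_addr//=; apply: cvgD => //; exact: rownorm_cvg.
Qed.

Lemma sum_rowlim_le x K : \sum_(0 <= k < K) rowlim x k <= `|x|.
Proof.
apply: (cvgr_to_le (@sum_rownorm_cvg x 0 K)); apply: nearW => I.
exact: norm_ge_box.
Qed.

(** The sums of full row norms lie between the square box norms and the norm. *)
Lemma sum_rowlim_cvg x : \sum_(0 <= k < K) rowlim x k @[K --> \oo] --> `|x|.
Proof.
apply: (squeeze_cvgr _ (@boxnorm_cvg _ x) (cvg_cst `|x|)).
apply: nearW => K; rewrite sum_rowlim_le andbT ler_sum// => k _.
exact: rownorm_le_rowlim.
Qed.

(** The second gliding hump has whole rows as blocks, measured by their norms, which tend to 0 by
    the first one. The test functional norms row [k] of the vector [u (s k)]. *)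
Lemma weakly_null_cvg0 : `|u n| @[n --> \oo] --> 0.
Proof.
pose a (s : nat -> nat) k : nat -> R^o := norming (u (s k)) k.
have a1 s : admissible 1 (a s) := admissible_norming (fun k => u (s k)).
apply: (@gliding_hump _ (fun k n => rowlim (u n) k) (fun n => `|u n|)
   (fun s n => pairing (a s) (u n))).
- by move=> k n; exact: rowlim_ge0.
- by move=> n; exact: sum_rowlim_cvg.
- move=> k; apply: (@squeeze_cvgr _ _ _ _ (fun=> 0) (fun n => 2 * rowl1 (u n) k)).
  + by apply: nearW => n; rewrite rowlim_ge0 rowlim_le.
  + exact: cvg_cst.
  + by have /(cvgM (cvg_cst (2 : R))) := @rowl1_cvg0 k; rewrite mulr0.
- move=> s n B B' sn BB'.
  have key : \forall m \near \oo,
      2 * \sum_(B <= k < B') rownorm (u n) k m - `|u n| <= boxpair m m (a s) (u n).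
    (* [norming_row] needs the argmax of each row of the block to lie among the first [m]
       columns. *)
    pose M := \max_(k < B') (argrow (u n) k).+1.
    exists (maxn M B') => // m /=; rewrite geq_max => /andP[Mm Bm].
    have := norm_ge_box m m (u n); rewrite /boxpair /boxnorm.
    rewrite !(@big_cat_nat _ _ _ B 0 m)//= ?(leq_trans BB')//.
    rewrite !(@big_cat_nat _ _ _ B' B m)//=.
    have mid : \sum_(B <= k < B') \sum_(0 <= i < m) a s k i * u n k i =
               \sum_(B <= k < B') rownorm (u n) k m.
      apply: eq_big_nat => k kB; rewrite /a (sn k kB) norming_row//.
      case/andP: kB => _ kB; apply: leq_trans Mm.
      exact: (@leq_bigmax _ (fun l : 'I_B' => (argrow (u n) l).+1) (Ordinal kB)).
    have low D D' : - \sum_(D <= k < D') rownorm (u n) k m <=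
        \sum_(D <= k < D') \sum_(0 <= i < m) a s k i * u n k i.
      rewrite -sumrN ler_sum// => k _; rewrite lerNl.
      have := @admissible_row _ _ _ (u n) k m (a1 s); rewrite mul1r.
      apply: le_trans; rewrite (le_trans (ler_norm _))// normrN.
      exact: ler_norm_sum.
    have := low 0%N B; have := low B' m; rewrite mid; lra.
  apply: (ler_cvg_to _ (@boxpair_is_cvg _ _ _ (u n) (a1 s)) key).
  apply: cvgB; last exact: cvg_cst.
  by apply: cvgM; [exact: cvg_cst|exact: sum_rownorm_cvg].
- by move=> s; exact: (u0 (pairing_dual (a1 s))).
Qed.

End WeaklyNull.

Lemma mixedl1_Schur : Schur_property (mixedl1 R).
Proof.
move=> u [x ux]; apply/cvg_ex; exists x.
have /cvgr0Pnorm_lt v0 : `|u n - x| @[n --> \oo] --> 0.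
  apply: (@weakly_null_cvg0 (fun n => u n - x)) => f.
  have fu := @weak_cvg_eval _ _ u x f ux.
  rewrite -(subrr (f x)); under eq_fun do rewrite linearB.
  by apply: cvgB => //; exact: cvg_cst.
apply/cvgrPdist_lt => e /v0; apply: filterS => n.
by rewrite normr_id distrC.
Qed.

End SchurProperty.

(** * Failure of every C-Schur inequality *)

Section NonSchurConstant.
Context {R : realType}.

(** Every tail contains some [unitv k n] and [unitv k n.+1], whose difference has entry 1 in row [k]
    and column [n]. *)
Lemma ca_unitv k : (1 <= ca (fun n => unitv k n : mixedl1 R))%E.
Proof.
apply/ereal_infP => _ [n _ <-].
apply: (@le_trans _ _ (`|unitv k n - unitv k n.+1 : mixedl1 R|%:E)%E).
  rewrite lee_fin (le_trans _ (norm_ge_entry _ k n))// entryB !unitvE !eqxx.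
  by rewrite (ltn_eqF (ltnSn n)) subr0 normr1.
apply: ereal_sup_ubound; exists (unitv k n); first by exists n => //=.
by exists (unitv k n.+1) => //; exists n.+1 => //=.
Qed.

(** The excesses of the values over [weight k] are summable along the row, so eventually a single
    excess is at most [e]. *)
Lemma dual_unitv_near (f : dual_space (mixedl1 R)) k (e : R) : `|f| <= 1 -> 0 < e ->
  \forall n \near \oo, `|f (unitv k n)| <= weight k + e.
Proof.
move=> f1 e0; have a1 := admissibleW f1 (@admissible_dual _ f).
have [I IP] := excess_tail k.+1 e0 a1.
exists I => // n /= In; have := IP k n n.+1 (ltnSn k) In.
by rewrite big_nat1 ge_max => /andP[_]; rewrite lerBlDl.
Qed.

Lemma clust_unitv k (F : bidual (mixedl1 R)) :
  clust (fun n => unitv k n) F -> `|F| <= weight k.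
Proof.
move=> uF; apply: dual_norm_le => f f1; apply/ler_addgt0Pr => e e0.
exact: clust_eval uF (dual_unitv_near k f1 e0).
Qed.

Lemma delta_unitv k :
  (delta (fun n => unitv k n : mixedl1 R) <= (2 * weight k)%:E)%E.
Proof.
apply/ereal_supP => _ [F /clust_unitv Fk [G /clust_unitv Gk <-]].
rewrite lee_fin (le_trans (ler_normB _ _))// mulr_natl mulr2n.
exact: lerD.
Qed.

Lemma mixedl1_not_C_Schur (C : R) : 0 <= C -> ~ C_Schur_property C (mixedl1 R).
Proof.
move=> C0 CS.
(* This choice makes [2 * C * weight k] less than 1, whereas the C-Schur inequality would force it
   to be at least 1. *)
pose k := Num.truncn (2 * C).
have kC : 2 * C < k.+1%:R by rewrite -truncn_lt_nat ?mulr_ge0.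
have bu : bounded_fun (fun n => unitv k n : mixedl1 R).
  by exists 2; split=> // M M2 n _ /=; rewrite (le_trans (norm_unitv k n))// ltW.
have := le_trans (ca_unitv k) (le_trans (CS _ bu) (lee_wpmul2l _ (delta_unitv k))).
rewrite lee_fin => /(_ C0); rewrite lee_fin mulrCA mulrA /weight.
by rewrite ler_pdivlMr ?ltr0n// mul1r leNgt kC.
Qed.

End NonSchurConstant.

Theorem mainTheorem2 (R : realType) :
  exists X : completeNormedModType R,
    [/\ separable_space X, L_embedded X, Schur_property X
      & forall C : R, 0 <= C -> ~ C_Schur_property C X].
Proof.
exists (mixedl1 R); split.
- exact: mixedl1_separable.
- exact: mixedl1_L_embedded.
- exact: mixedl1_Schur.
- exact: mixedl1_not_C_Schur.
Qed.
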